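(* Let $E: y^2=x^3+ax^2+bx+c$ ($a,b,c\in\mathbb{Z}$) be an elliptic curve and $P\in E(\mathbb{Q})$ a point of infinite order. For every $k\ge1$, with $F_k=F_k(E,P)$ and $\tau_k=\frac{2n_{k-1}}{F_k}$, the following hold: \[F_k=\frac{2n_{k-1}}{\tau_k},\] \[n_k=\frac{-2am_{k-1}m_ke_{k-1}^2-bm_{k-1}e_{k-1}^4F_k^2-bm_ke_{k-1}^4-2ce_{k-1}^6F_k^2+m_{k-1}^3F_k^2-3m_{k-1}^2m_k}{\tau_k},\] \[m_k=\frac{m_{k-1}^4-2bm_{k-1}^2e_{k-1}^4-8cm_{k-1}e_{k-1}^6+b^2e_{k-1}^8-4ace_{k-1}^8}{\tau_k^2},\] \[e_k=F_0F_1\cdots F_k.\]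
   Context: An elliptic curve is a non-singular cubic $y^2=x^3+ax^2+bx+c$ with $a,b,c\in\mathbb{Z}$. For $k\ge0$ write $2^kP=\left(\frac{m_k}{e_k^2},\frac{n_k}{e_k^3}\right)$ with $m_k,n_k,e_k\in\mathbb{Z}$, $e_k\ge1$, $\gcd(m_k,e_k)=\gcd(n_k,e_k)=1$. Define $F_0(E,P)=e_0$ and $F_k(E,P)=e_k/e_{k-1}$ for $k\ge1$. *)

(* Defs.v *)
From HB Require Import structures.
From mathcomp Require Import all_boot all_order all_algebra all_field.

Set Implicit Arguments.
Unset Strict Implicit.
Unset Printing Implicit Defensive.

Import Order.TTheory GRing.Theory Num.Theory.
Local Open Scope ring_scope.

(* No point of y^2 = x^3 + a x^2 + b x + c over the algebraic closure kills
   both partial derivatives; the point at infinity of such a cubic is always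
   smooth, so it needs no condition. *)
Definition nonsingular (a b c : int) : Prop :=
  forall x y : algC,
    y ^+ 2 = x ^+ 3 + a%:~R * x ^+ 2 + b%:~R * x + c%:~R ->
    ~ (2 * y = 0 /\ 3 * x ^+ 2 + 2 * a%:~R * x + b%:~R = 0).

Inductive point : Type :=
| Infinity
| Affine of rat & rat.

Definition on_curve (a b c : int) (P : point) : Prop :=
  match P with
  | Infinity => True
  | Affine x y => y ^+ 2 = x ^+ 3 + a%:Q * x ^+ 2 + b%:Q * x + c%:Q
  end.

(* Chord-and-tangent law. The coefficient c does not occur in the formulas.
   For points of the curve with x1 = x2 and y1 <> - y2 one has y1 = y2 <> 0,
   which is the tangent case. *)
Definition ec_add (a b : int) (P Q : point) : point :=
  match P, Q with
  | Infinity, _ => Q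
  | _, Infinity => P
  | Affine x1 y1, Affine x2 y2 =>
      if (x1 == x2) && (y1 == - y2) then Infinity
      else
        let l := if x1 == x2
                 then (3 * x1 ^+ 2 + 2 * a%:Q * x1 + b%:Q) / (2 * y1)
                 else (y2 - y1) / (x2 - x1) in
        let x3 := l ^+ 2 - a%:Q - x1 - x2 in
        Affine x3 (l * (x1 - x3) - y1)
  end.

Definition ec_mul (a b : int) (n : nat) (P : point) : point :=
  iter n (ec_add a b P) Infinity.

Definition infinite_order (a b : int) (P : point) : Prop :=
  forall n : nat, (0 < n)%N -> ec_mul a b n P <> Infinity.

(* Signs are pinned down by 1 <= e k, so m, n, e are determined by P. *)
Definition coordinates_2powers (a b : int) (P : point) (m n e : nat -> int)
    : Prop :=
  forall k : nat,
    [/\ ec_mul a b (2 ^ k)%N P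
          = Affine ((m k)%:Q / (e k)%:Q ^+ 2) ((n k)%:Q / (e k)%:Q ^+ 3),
        1 <= e k,
        gcdz (m k) (e k) = 1
      & gcdz (n k) (e k) = 1].

Definition Fseq (e : nat -> int) (k : nat) : rat :=
  if k is j.+1 then (e k)%:Q / (e j)%:Q else (e 0%N)%:Q.

Definition tau (n e : nat -> int) (k : nat) : rat :=
  2 * (n k.-1)%:Q / Fseq e k.

(* Main.v *)
(* The formulas are the duplication formula in the coordinates x = m/e^2,
   y = n/e^3, since 2^k P is the double of 2^(k-1) P.  Multiples being iterated
   additions of P, this last fact is an instance of associativity.

   To compare (P + Q) + R with P + (Q + R), where x1, x2, x3 are the abscissas
   of P, Q, R, let the line y = L through P, Q and the line y = M through Q, R
   meet the curve again above x4 and x5.  If the slopes of L and M differ by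
   d <> 0, put k = (x5 - x4)/d.  The lines y = M + k(x - x3), through P + Q and
   R, and y = L + k(x - x1), through P and Q + R, cross at a point of the curve,
   which is the third intersection of both.  This is an identity of polynomials,
   insensitive to whether a line is a chord or a tangent.  If the slopes agree,
   then L = M, and either P = R or both sums are the point at infinity. *)
Require Import Defs.
From HB Require Import structures.
From mathcomp Require Import all_boot all_order all_algebra all_field.
From mathcomp Require Import ring.

Set Implicit Arguments.
Unset Strict Implicit.
Unset Printing Implicit Defensive.

Import Order.TTheory GRing.Theory Num.Theory.
Local Open Scope ring_scope.

Section Secant.
Variable F : fieldType.
Implicit Types (f L M : {poly F}) (a b c l v x y : F).

Definition cubic a b c : {poly F} := 'X^3 + a%:P * 'X^2 + b%:P * 'X + c%:P.

Definition line l v : {poly F} := l%:P * 'X + v%:P.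

(* The line y = L meets y^2 = f above x1, x2, x3, counted with multiplicity. *)
Definition secant f L x1 x2 x3 : Prop :=
  f - L ^+ 2 = ('X - x1%:P) * ('X - x2%:P) * ('X - x3%:P).

Lemma horner_cubic a b c x :
  (cubic a b c).[x] = x ^+ 3 + a * x ^+ 2 + b * x + c.
Proof. by rewrite !hornerE. Qed.

Lemma horner_line l v x : (line l v).[x] = l * x + v.
Proof. by rewrite !hornerE. Qed.

Lemma opp_line l v : - line l v = line (- l) (- v).
Proof. by rewrite /line; ring. Qed.

Lemma secant_swap12 f L x1 x2 x3 : secant f L x1 x2 x3 -> secant f L x2 x1 x3.
Proof. by rewrite /secant => ->; ring. Qed.

Lemma secant_swap23 f L x1 x2 x3 : secant f L x1 x2 x3 -> secant f L x1 x3 x2.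
Proof. by rewrite /secant => ->; ring. Qed.

Lemma secantN f L x1 x2 x3 : secant f L x1 x2 x3 -> secant f (- L) x1 x2 x3.
Proof. by rewrite /secant sqrrN. Qed.

Lemma secant_horner f L x1 x2 x3 x : secant f L x1 x2 x3 ->
  f.[x] - L.[x] ^+ 2 = (x - x1) * (x - x2) * (x - x3).
Proof. by move=> /(congr1 (horner^~ x)); rewrite !hornerE. Qed.

Lemma secant_coefP a b c l v x1 x2 x3 :
  secant (cubic a b c) (line l v) x1 x2 x3 <->
  [/\ a = l ^+ 2 - x1 - x2 - x3,
      b = x1 * x2 + x1 * x3 + x2 * x3 + 2 * l * v
    & c = v ^+ 2 - x1 * x2 * x3].
Proof.
rewrite /secant /cubic /line; split=> [secL | [-> -> ->]]; last by ring.
pose da := a - (l ^+ 2 - x1 - x2 - x3).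
pose db := b - (x1 * x2 + x1 * x3 + x2 * x3 + 2 * l * v).
pose dc := c - (v ^+ 2 - x1 * x2 * x3).
have diff0 : da%:P * 'X^2 + db%:P * 'X + dc%:P = 0.
  by move/eqP: secL; rewrite -subr_eq0 => /eqP <-; rewrite /da /db /dc; ring.
have coef_diff0 i : (da%:P * 'X^2 + db%:P * 'X + dc%:P)`_i = 0.
  by rewrite diff0 coef0.
move: (coef_diff0 2%N) (coef_diff0 1%N) (coef_diff0 0%N).
rewrite !coefE /= !(mulr0, mulr1, addr0, add0r).
by do 3![move/eqP; rewrite subr_eq0 => /eqP ?].
Qed.

Lemma chord_secant a b c x1 y1 x2 y2 (l := (y2 - y1) / (x2 - x1)) :
  y1 ^+ 2 = (cubic a b c).[x1] -> y2 ^+ 2 = (cubic a b c).[x2] -> x1 != x2 ->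
  secant (cubic a b c) (line l (y1 - l * x1)) x1 x2 (l ^+ 2 - a - x1 - x2).
Proof.
rewrite !horner_cubic => y1E y2E x12; apply/secant_coefP.
have x21_neq0 : x2 - x1 != 0 by rewrite subr_eq0 eq_sym.
have bE : b = (y2 ^+ 2 - y1 ^+ 2 - x2 ^+ 3 + x1 ^+ 3
               - a * (x2 ^+ 2 - x1 ^+ 2)) / (x2 - x1) by rewrite y1E y2E; field.
have cE : c = y1 ^+ 2 - x1 ^+ 3 - a * x1 ^+ 2 - b * x1 by rewrite y1E; ring.
by split; rewrite ?cE ?bE /l; [ring | field | field].
Qed.

Lemma tangent_secant a b c x y
    (l := (3 * x ^+ 2 + 2 * a * x + b) / (2 * y)) :
  y ^+ 2 = (cubic a b c).[x] -> 2 * y != 0 ->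
  secant (cubic a b c) (line l (y - l * x)) x x (l ^+ 2 - a - x - x).
Proof.
rewrite horner_cubic => yE; rewrite mulf_eq0 negb_or => /andP[two_neq0 y_neq0].
have cE : c = y ^+ 2 - x ^+ 3 - a * x ^+ 2 - b * x by rewrite yE; ring.
apply/secant_coefP; split; rewrite ?cE /l; [ring | field | field].
all: by rewrite y_neq0 two_neq0.
Qed.

Section Pivot.
Variables (f L M : {poly F}) (d x1 x2 x3 x4 x5 : F).
Hypothesis secL : secant f L x1 x2 x4.
Hypothesis secM : secant f M x2 x3 x5.
Hypothesis subLM : L - M = d%:P * ('X - x2%:P).

Lemma secant_sum_lines :
  d%:P * (L + M) = ('X - x3%:P) * ('X - x5%:P) - ('X - x1%:P) * ('X - x4%:P).
Proof.
apply: (mulfI (negbT (polyXsubC_eq0 x2))).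
transitivity ((L - M) * (L + M)); first by rewrite subLM; ring.
transitivity ((f - M ^+ 2) - (f - L ^+ 2)); first by ring.
by rewrite secL secM; ring.
Qed.

Hypothesis d_neq0 : d != 0.

Lemma horner_pivot :
  (M + ((x5 - x4) / d)%:P * ('X - x3%:P)).[x4] = - L.[x4].
Proof.
apply: (mulfI d_neq0).
have /(congr1 (horner^~ x4)) := secant_sum_lines.
rewrite !hornerE subrr mulr0 subr0 => sumE.
transitivity (d * (L.[x4] + M.[x4]) + (x5 - x4) * (x4 - x3) - d * L.[x4]).
  by field.
by rewrite sumE; ring.
Qed.

(* Factoring out X - x3 and multiplying by d leaves a combination of d (L + M)
   and L - M, both of which are known. *)
Lemma secant_pivot :
  secant f (M + ((x5 - x4) / d)%:P * ('X - x3%:P)) x4 x3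
    (x2 + (x5 - x4) * (x1 - x3) / d ^+ 2).
Proof.
set k := (x5 - x4) / d; set h := _ / d ^+ 2.
have x5E : x5 = x4 + d * k by rewrite /k; field.
have dhE : d * h = k * (x1 - x3) by rewrite /h /k; field.
have dP_neq0 : d%:P != 0 by rewrite polyC_eq0.
apply: (mulfI dP_neq0).
have -> : f = M ^+ 2 + ('X - x2%:P) * ('X - x3%:P) * ('X - x5%:P).
  by rewrite -secM; ring.
transitivity (('X - x3%:P) * (d%:P * ('X - x2%:P) * ('X - x5%:P)
    - k%:P * (d%:P * (L + M)) + d%:P * k%:P * (L - M)
    - d%:P * k%:P ^+ 2 * ('X - x3%:P))); first by ring.
transitivity (('X - x4%:P) * ('X - x3%:P)
    * (d%:P * ('X - x2%:P) - (d * h)%:P)); last by ring.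
by rewrite secant_sum_lines subLM dhE x5E; ring.
Qed.

End Pivot.

Lemma line_sub l v g w x :
  (line l v).[x] = (line g w).[x] ->
  line l v - line g w = (l - g)%:P * ('X - x%:P).
Proof. by rewrite !horner_line /line => /(canRL (addKr _)) ->; ring. Qed.

Lemma line_pivot l v k x :
  line l v + k%:P * ('X - x%:P) = line (l + k) (v - k * x).
Proof. by rewrite /line; ring. Qed.

Lemma horner_line_pivot l v k x :
  (line (l + k) (v - k * x)).[x] = (line l v).[x].
Proof. by rewrite !horner_line; ring. Qed.

Lemma secant_assoc f l v g w x1 x2 x3 x4 x5 (L := line l v) (M := line g w)
    (k := (x5 - x4) / (l - g))
    (L' := line (l + k) (v - k * x1)) (M' := line (g + k) (w - k * x3))
    (x6 := x2 + (x5 - x4) * (x1 - x3) / (l - g) ^+ 2) :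
  secant f L x1 x2 x4 -> secant f M x2 x3 x5 -> L.[x2] = M.[x2] -> l != g ->
  [/\ secant f M' x4 x3 x6, secant f L' x1 x5 x6,
      M'.[x4] = - L.[x4], L'.[x5] = - M.[x5] & M'.[x6] = L'.[x6]].
Proof.
move=> secL secM LM2; rewrite -subr_eq0 => d_neq0.
have Nd_neq0 : g - l != 0 by rewrite -opprB oppr_eq0.
have secL' := secant_swap12 secL; have secM' := secant_swap12 secM.
have LM := line_sub LM2; have ML := line_sub (esym LM2).
have kE : (x4 - x5) / (g - l) = k.
  by rewrite -opprB -[g - l]opprB invrN mulrNN.
have x6E : x2 + (x4 - x5) * (x3 - x1) / (g - l) ^+ 2 = x6.
  by rewrite -sqrrN -(mulrNN (x4 - x5)) !opprB.
rewrite /M' /L' -!line_pivot; split.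
- exact: secant_pivot secL secM LM d_neq0.
- apply: secant_swap12; rewrite -x6E -kE.
  exact: secant_pivot secM' secL' ML Nd_neq0.
- exact: horner_pivot secL secM LM d_neq0.
- by rewrite -kE; exact: horner_pivot secM' secL' ML Nd_neq0.
have -> : line l v = M + (l - g)%:P * ('X - x2%:P) by rewrite -LM addrC subrK.
by rewrite !hornerE /x6 /k; field.
Qed.

Lemma secant_other_roots f L x1 x2 x3 x4 x5 :
  secant f L x1 x2 x4 -> secant f L x2 x3 x5 ->
  x1 = x3 /\ x4 = x5 \/ x1 = x5 /\ x4 = x3.
Proof.
rewrite /secant => secL secL'.
have roots : ('X - x1%:P) * ('X - x4%:P) = ('X - x3%:P) * ('X - x5%:P).
  apply: (mulfI (negbT (polyXsubC_eq0 x2))).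
  transitivity (f - L ^+ 2); first by rewrite secL; ring.
  by rewrite secL'; ring.
have /eqP := congr1 (horner^~ x1) roots.
rewrite !hornerE subrr mul0r eq_sym mulf_eq0 !subr_eq0.
case/orP=> /eqP x1E; [left | right]; split=> //; move: roots; rewrite -x1E.
  by move/(mulfI (negbT (polyXsubC_eq0 x1)))/addrI/oppr_inj/polyC_inj.
rewrite mulrC.
by move/(mulIf (negbT (polyXsubC_eq0 x1)))/addrI/oppr_inj/polyC_inj.
Qed.

End Secant.

Definition above (L : {poly rat}) (x : rat) : point := Affine x L.[x].

Definition ec_opp (P : point) : point :=
  if P is Affine x y then Affine x (- y) else Infinity.

Lemma ec_oppK : involutive ec_opp.
Proof. by case=> //= x y; rewrite opprK. Qed.

Lemma above_opp L x : above (- L) x = ec_opp (above L x).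
Proof. by rewrite /above hornerN. Qed.

Section EllipticCurve.
Variables a b c : int.
Hypothesis nonsingE : nonsingular a b c.

Local Notation f := (cubic a%:Q b%:Q c%:Q).
Local Notation add := (ec_add a b).
Local Notation on_E := (on_curve a b c).

Lemma on_curve_cubic x y : on_E (Affine x y) = (y ^+ 2 = f.[x]).
Proof. by rewrite horner_cubic. Qed.

Lemma on_curve_opp P : on_E P -> on_E (ec_opp P).
Proof. by case: P => //= x y; rewrite sqrrN. Qed.

Lemma secant_on_curve L x1 x2 x3 : secant f L x1 x2 x3 ->
  [/\ on_E (above L x1), on_E (above L x2) & on_E (above L x3)].
Proof.
move=> secL.
have root_on_E x : (x - x1) * (x - x2) * (x - x3) = 0 -> on_E (above L x).
  rewrite -(secant_horner x secL) => /eqP; rewrite subr_eq0 => /eqP fx.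
  by rewrite /above on_curve_cubic.
by split; apply: root_on_E; ring.
Qed.

Lemma deriv_cubic_neq0 x :
  on_E (Affine x 0) -> 3 * x ^+ 2 + 2 * a%:Q * x + b%:Q != 0.
Proof.
move=> xE; apply/eqP => dxE.
have ratrE := (rmorphD, rmorphXn, rmorphM, rmorph_nat, rmorph_int, rmorph0).
apply: (nonsingE (x := ratr x) (y := 0)).
  by move/(congr1 (@ratr algC)): xE; rewrite !ratrE.
split; first by rewrite mulr0.
by move/(congr1 (@ratr algC)): dxE; rewrite !ratrE.
Qed.

Lemma ec_add_Infinity_r P : add P Infinity = P.
Proof. by case: P. Qed.

Lemma ec_addNl P : add (ec_opp P) P = Infinity.
Proof. by case: P => //= x y; rewrite !eqxx. Qed.

Lemma ec_addNr P : add P (ec_opp P) = Infinity.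
Proof. by rewrite -{1}(ec_oppK P) ec_addNl. Qed.

Variant ec_add_spec (P Q : point) : point -> Prop :=
| EcAddInfinity of Q = ec_opp P : ec_add_spec P Q Infinity
| EcAddSecant l v x1 x2 x3 of P = above (line l v) x1
    & Q = above (line l v) x2 & secant f (line l v) x1 x2 x3 :
    ec_add_spec P Q (ec_opp (above (line l v) x3)).

Lemma ec_addP x1 y1 x2 y2 (P := Affine x1 y1) (Q := Affine x2 y2) :
  on_E P -> on_E Q -> ec_add_spec P Q (add P Q).
Proof.
rewrite /P /Q !on_curve_cubic /ec_add => y1E y2E.
have secant_spec l x3 : y2 = l * x2 + (y1 - l * x1) ->
    secant f (line l (y1 - l * x1)) x1 x2 x3 ->
    ec_add_spec P Q (Affine x3 (l * (x1 - x3) - y1)).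
  move=> y2L secL.
  have -> : Affine x3 (l * (x1 - x3) - y1)
      = ec_opp (above (line l (y1 - l * x1)) x3).
    by rewrite /above /= horner_line; congr Affine; ring.
  apply: EcAddSecant secL; rewrite /above horner_line; last by rewrite -y2L.
  by rewrite addrC subrK.
have [x12 | x12] /= := eqVneq x1 x2; last first.
  apply: secant_spec; last exact: chord_secant.
  by field; rewrite subr_eq0 eq_sym.
rewrite /P /Q -x12 in y2E secant_spec *.
case: eqVneq => [-> | y1_neqN] /=; first by constructor; rewrite /= opprK.
have y12 : y1 = y2.
  have /eqP : y1 ^+ 2 = y2 ^+ 2 by rewrite y1E.
  by rewrite eqf_sqr (negPf y1_neqN) orbF => /eqP.
have y1_neq0 : y1 != 0 by rewrite -y12 eq_sym eqNr in y1_neqN.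
apply: secant_spec; first by rewrite y12; ring.
by apply: tangent_secant; rewrite ?mulf_neq0.
Qed.

Lemma secant_ec_add l v x1 x2 x3 : secant f (line l v) x1 x2 x3 ->
  add (above (line l v) x1) (above (line l v) x2)
    = ec_opp (above (line l v) x3).
Proof.
move=> secL; have [aE bE _] := (secant_coefP _ _ _ _ _ _ _ _).1 secL.
have [onE1 _ _] := secant_on_curve secL.
rewrite /above !horner_line /ec_add in onE1 *.
have [x12 | x12] /= := eqVneq x1 x2; last first.
  have -> : (l * x2 + v - (l * x1 + v)) / (x2 - x1) = l.
    by field; rewrite subr_eq0 eq_sym.
  by rewrite aE; congr Affine; ring.
rewrite -{x2}x12 in aE bE secL *.
have dxE : 3 * x1 ^+ 2 + 2 * a%:Q * x1 + b%:Q = 2 * (l * x1 + v) * l.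
  by rewrite aE bE; ring.
have y1_neq0 : l * x1 + v != 0.
  apply/eqP => y1_eq0; rewrite y1_eq0 mulr0 mul0r in dxE onE1.
  by move/eqP: dxE; apply/negP/deriv_cubic_neq0.
rewrite [_ == - _]eq_sym eqNr (negPf y1_neq0) dxE aE.
have -> : 2 * (l * x1 + v) * l / (2 * (l * x1 + v)) = l by field.
by congr Affine; ring.
Qed.

Lemma ec_add_on_curve P Q : on_E P -> on_E Q -> on_E (add P Q).
Proof.
case: P Q => [|x1 y1] [|x2 y2] // EP EQ.
case: (ec_addP EP EQ) => // l v ? ? x3 _ _ secL.
by have [_ _ /on_curve_opp] := secant_on_curve secL.
Qed.

Lemma ec_addC P Q : on_E P -> on_E Q -> add P Q = add Q P.
Proof.
case: P Q => [|x1 y1] [|x2 y2] // EP EQ.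
case: (ec_addP EP EQ) => [-> | l v ? ? x3 -> -> /secant_swap12 secL].
  by rewrite ec_addNl.
by rewrite (secant_ec_add secL).
Qed.

Lemma ec_addKl P Q : on_E P -> on_E Q -> add (ec_opp P) (add P Q) = Q.
Proof.
case: P Q => [|x1 y1] [|x2 y2] // EP EQ; first exact: ec_addNl.
case: (ec_addP EP EQ) => [-> // | l v ? ? x3 -> -> secL].
have secN := secant_swap23 (secantN secL); rewrite opp_line in secN.
rewrite -!above_opp opp_line (secant_ec_add secN).
by rewrite -opp_line above_opp ec_oppK.
Qed.

Lemma ec_addKr P Q : on_E P -> on_E Q -> add (add P Q) (ec_opp Q) = P.
Proof.
move=> EP EQ; rewrite (ec_addC EP EQ) ec_addC ?ec_addKl //.
  exact: ec_add_on_curve.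
exact: on_curve_opp.
Qed.

Lemma ec_addA_secant l v g w x1 x2 x3 x4 x5 (L := line l v) (M := line g w) :
  secant f L x1 x2 x4 -> secant f M x2 x3 x5 -> L.[x2] = M.[x2] ->
  add (ec_opp (above L x4)) (above M x3)
    = add (above L x1) (ec_opp (above M x5)).
Proof.
move=> secL secM LM2; have [lg | lg] := eqVneq l g.
  have LM : L = M.
    by apply/eqP; rewrite -subr_eq0 (line_sub LM2) lg subrr mul0r.
  rewrite -LM in secM *.
  have [[<- <-] | [<- <-]] := secant_other_roots secL secM.
    have [onE1 _ onE4] := secant_on_curve secL.
    exact: ec_addC (on_curve_opp onE4) onE1.
  by rewrite ec_addNl ec_addNr.
have [secM' secL' M'x4 L'x5 ML'x6] := secant_assoc secL secM LM2 lg.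
set L' := line _ _ in secL' L'x5 ML'x6; set M' := line _ _ in secM' M'x4 ML'x6.
have <- : above M' x4 = ec_opp (above L x4) by rewrite /above M'x4.
have <- : above L' x5 = ec_opp (above M x5) by rewrite /above L'x5.
have <- : above M' x3 = above M x3 by rewrite /above horner_line_pivot.
have <- : above L' x1 = above L x1 by rewrite /above horner_line_pivot.
by rewrite (secant_ec_add secM') (secant_ec_add secL') /above ML'x6.
Qed.

Lemma ec_addA P Q R : on_E P -> on_E Q -> on_E R ->
  add (add P Q) R = add P (add Q R).
Proof.
case: P Q R => [|x1 y1] [|x2 y2] [|x3 y3] // EP EQ ER;
  rewrite ?ec_add_Infinity_r //.
case: (ec_addP EP EQ) => [QE | l v ? x ? PE QE secL].
  by rewrite QE -{1}[Affine x1 y1]ec_oppK ec_addKl //; apply: on_curve_opp.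
case: (ec_addP EQ ER) => [-> | g w ? ? ? QE' -> secM].
  by rewrite ec_add_Infinity_r -(secant_ec_add secL) -PE -QE ec_addKr.
rewrite PE; case: QE secL => <- y2L secL; case: QE' secM => <- y2M secM.
by apply: ec_addA_secant secL secM _; rewrite -y2L.
Qed.

Lemma ec_mul_on_curve P i : on_E P -> on_E (ec_mul a b i P).
Proof. by move=> EP; elim: i => //= i; exact: ec_add_on_curve. Qed.

Lemma ec_mulD P i j : on_E P ->
  ec_mul a b (i + j) P = add (ec_mul a b i P) (ec_mul a b j P).
Proof.
move=> EP; elim: i => //= i ->; rewrite ec_addA //; exact: ec_mul_on_curve.
Qed.

Lemma ec_mul_expnS P k : on_E P ->
  ec_mul a b (2 ^ k.+1) P = add (ec_mul a b (2 ^ k) P) (ec_mul a b (2 ^ k) P).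
Proof. by move=> EP; rewrite expnS mul2n -addnn ec_mulD. Qed.

End EllipticCurve.

Lemma ec_double (a b c : int) x y x' y' :
  on_curve a b c (Affine x y) ->
  ec_add a b (Affine x y) (Affine x y) = Affine x' y' ->
  [/\ y != 0,
      x' = (x ^+ 4 - 2 * b%:Q * x ^+ 2 - 8 * c%:Q * x
            + b%:Q ^+ 2 - 4 * a%:Q * c%:Q) / (2 * y) ^+ 2
    & y' = (- 2 * a%:Q * x * x' - b%:Q * x - b%:Q * x' - 2 * c%:Q
            + x ^+ 3 - 3 * x ^+ 2 * x') / (2 * y)].
Proof.
rewrite /on_curve /ec_add eqxx /= eq_sym eqNr => yE.
case: eqVneq => //= y_neq0 [<- <-].
have cE : c%:Q = y ^+ 2 - x ^+ 3 - a%:Q * x ^+ 2 - b%:Q * x by rewrite yE; ring.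
by rewrite cE; split=> //; field.
Qed.

Lemma ec_double_jacobian (a b c : int) (m n e m' n' e' : rat)
    (P := Affine (m / e ^+ 2) (n / e ^+ 3)) (F := e' / e) (t := 2 * n / F) :
  e != 0 -> e' != 0 -> on_curve a b c P ->
  ec_add a b P P = Affine (m' / e' ^+ 2) (n' / e' ^+ 3) ->
  [/\ F = 2 * n / t,
      n' = (- 2 * a%:Q * m * m' * e ^+ 2 - b%:Q * m * e ^+ 4 * F ^+ 2
            - b%:Q * m' * e ^+ 4 - 2 * c%:Q * e ^+ 6 * F ^+ 2
            + m ^+ 3 * F ^+ 2 - 3 * m ^+ 2 * m') / t
    & m' = (m ^+ 4 - 2 * b%:Q * m ^+ 2 * e ^+ 4 - 8 * c%:Q * m * e ^+ 6
            + b%:Q ^+ 2 * e ^+ 8 - 4 * a%:Q * c%:Q * e ^+ 8) / t ^+ 2].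
Proof.
move=> e_neq0 e'_neq0 onE /(ec_double onE)[y_neq0 x'E y'E].
have n_neq0 : n != 0 by apply: contra_neq y_neq0 => ->; rewrite mul0r.
have m'E : m' = m' / e' ^+ 2 * e' ^+ 2 by field.
have n'E : n' = n' / e' ^+ 3 * e' ^+ 3 by field.
rewrite /t /F; split; first by field; rewrite e_neq0 e'_neq0 n_neq0.
  by rewrite [LHS]n'E y'E; field; rewrite e_neq0 e'_neq0 n_neq0.
by rewrite [LHS]m'E x'E; field; rewrite e_neq0 e'_neq0 n_neq0.
Qed.

Lemma prod_Fseq (e : nat -> int) k : (forall i, (e i)%:Q != 0) ->
  \prod_(0 <= i < k.+1) Fseq e i = (e k)%:Q.
Proof.
move=> e_neq0; elim: k => [|k IHk]; first by rewrite big_nat1.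
by rewrite big_nat_recr //= IHk mulrC divfK.
Qed.

Theorem theorem1p6 (a b c : int) (hE : nonsingular a b c)
    (P : point) (hP : on_curve a b c P) (hinf : infinite_order a b P)
    (m n e : nat -> int) (hmne : coordinates_2powers a b P m n e)
    (k : nat) (hk : (1 <= k)%N) :
  [/\ Fseq e k = 2 * (n k.-1)%:Q / tau n e k,
      (n k)%:Q =
        (- 2 * a%:Q * (m k.-1)%:Q * (m k)%:Q * (e k.-1)%:Q ^+ 2
         - b%:Q * (m k.-1)%:Q * (e k.-1)%:Q ^+ 4 * Fseq e k ^+ 2
         - b%:Q * (m k)%:Q * (e k.-1)%:Q ^+ 4
         - 2 * c%:Q * (e k.-1)%:Q ^+ 6 * Fseq e k ^+ 2
         + (m k.-1)%:Q ^+ 3 * Fseq e k ^+ 2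
         - 3 * (m k.-1)%:Q ^+ 2 * (m k)%:Q) / tau n e k,
      (m k)%:Q =
        ((m k.-1)%:Q ^+ 4
         - 2 * b%:Q * (m k.-1)%:Q ^+ 2 * (e k.-1)%:Q ^+ 4
         - 8 * c%:Q * (m k.-1)%:Q * (e k.-1)%:Q ^+ 6
         + b%:Q ^+ 2 * (e k.-1)%:Q ^+ 8
         - 4 * a%:Q * c%:Q * (e k.-1)%:Q ^+ 8) / tau n e k ^+ 2
    & (e k)%:Q = \prod_(0 <= i < k.+1) Fseq e i].
Proof.
have e_neq0 i : (e i)%:Q != 0.
  have [_ e_ge1 _ _] := hmne i.
  by rewrite intr_eq0 gt_eqF // (lt_le_trans _ e_ge1).
rewrite prod_Fseq //; case: k hk => // k _.
have [Pk _ _ _] := hmne k; have [PkS _ _ _] := hmne k.+1.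
have onE := ec_mul_on_curve (2 ^ k) hP; rewrite Pk in onE.
rewrite (ec_mul_expnS hE) // Pk in PkS.
by have [] := ec_double_jacobian (e_neq0 k) (e_neq0 k.+1) onE PkS.
Qed.
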